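(* Let $d\in\mathbb{N}$. For every $\alpha\in\mathbb{Q}[\sqrt d]\setminus\mathbb{Q}$ there exists $\varepsilon_1=\varepsilon_1(\alpha)>0$ such that the following is true. Let $\varepsilon\colon\mathbb{N}\to(0,\infty)$ and suppose that either there is a constant $\varepsilon_0<\varepsilon_1$ with $\varepsilon(n)\le\varepsilon_0$ for all $n$, or that $\varepsilon(n)\to0$ as $n\to\infty$. Then the set $\{n\in\mathbb{N} : \|\alpha n^2\|_{\mathbb{R}/\mathbb{Z}}<\varepsilon(n)\}$ is not a basis of order $2$.
   Context: $\mathbb{N}=\{0,1,2,\dots\}$ and $\|t\|_{\mathbb{R}/\mathbb{Z}}=\min_{n\in\mathbb{Z}}|t-n|$. A set $\mathcal{A}\subset\mathbb{N}$ is a basis of order $2$ if $2\mathcal{A}=\{n_1+n_2 : n_1,n_2\in\mathcal{A}\}$ contains all sufficiently large integers. *)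

(* Defs.v *)
From mathcomp Require Import all_boot all_order all_algebra.
From mathcomp Require Import all_classical all_reals all_analysis.
Set Implicit Arguments.
Unset Strict Implicit.
Unset Printing Implicit Defensive.
Import Order.TTheory GRing.Theory Num.Theory.
Import numFieldNormedType.Exports.
Local Open Scope classical_set_scope.
Local Open Scope ring_scope.

(* The distance from t to the nearest integer; the infimum is a minimum, see
   dist_intP. *)
Definition dist_int (R : realType) (t : R) : R :=
  inf [set `|t - n%:~R| | n in [set: int]].

Definition adjoin_rat (R : realType) (x : R) : set R :=
  [set (map_poly ratr p).[x] | p in [set: {poly rat}]].

Definition basis_order2 (A : set nat) : Prop :=
  \forall n \near \oo, [set (n1 + n2)%N | n1 in A & n2 in A] n.

Lemma dist_intP (R : realType) (t : R) :
  (exists n : int, dist_int t = `|t - n%:~R|) /\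
  (forall n : int, dist_int t <= `|t - n%:~R|).
Proof.
have lb0 : has_lbound [set `|t - n%:~R| | n in [set: int]].
  by exists 0 => _ [n _ <-].
have le_dist (n : int) : dist_int t <= `|t - n%:~R| by apply: ge_inf => //; exists n.
split=> //; set f := Num.floor t.
have [m mE] : exists m : int, forall n : int, `|t - m%:~R| <= `|t - n%:~R|.
  have f_le : f%:~R <= t by exact: floor_le.
  have lt_f : t < (f + 1)%:~R by exact: floorD1_gt.
  have lo (n : int) : n <= f -> `|t - f%:~R| <= `|t - n%:~R|.
    move=> nf; have nfR : n%:~R <= f%:~R :> R by rewrite ler_int.
    by rewrite !ger0_norm ?subr_ge0 ?(le_trans nfR)// lerB.
  have hi (n : int) : f < n -> `|t - (f + 1)%:~R| <= `|t - n%:~R|.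
    rewrite -lezD1 => fn.
    have fnR : (f + 1)%:~R <= n%:~R :> R by rewrite ler_int.
    by rewrite !ler0_norm ?subr_le0 ?(ltW (lt_le_trans lt_f fnR)) ?(ltW lt_f)// lerN2 lerB.
  case: (leP `|t - f%:~R| `|t - (f + 1)%:~R|) => h.
    exists f => n; have [/lo//|/hi] := leP n f; exact: le_trans.
  exists (f + 1) => n; have [/lo|/hi//] := leP n f.
  exact/le_trans/ltW.
exists m; apply/eqP; rewrite eq_le le_dist/=.
by apply: lb_le_inf; [exists `|t - 0%:~R|, 0 | move=> _ [n _ <-]].
Qed.

Lemma adjoin_rat_sqrtE (R : realType) (d : nat) (x : R) :
  adjoin_rat (Num.sqrt d%:R) x <->
  exists a b : rat, x = ratr a + ratr b * Num.sqrt d%:R.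
Proof.
split=> [[p _ <-]|[a [b ->]]]; last first.
  exists (a%:P + b%:P * 'X)%R => //.
  by rewrite rmorphD rmorphM /= !map_polyC /= map_polyX !hornerE.
elim/poly_ind: p => [|p c [a [b IH]]].
  by exists 0, 0; rewrite rmorph0 horner0 rmorph0 mul0r addr0.
rewrite rmorphD rmorphM /= map_polyX map_polyC /= !hornerE IH.
exists (b * d%:R + c), a.
have sd : Num.sqrt d%:R * Num.sqrt d%:R = d%:R :> R.
  by rewrite -expr2 sqr_sqrtr// ler0n.
rewrite mulrDl -(mulrA (ratr b)) sd rmorphD rmorphM /= ratr_nat.
by rewrite -addrA addrC.
Qed.

(* Main.v *)
Require Import Defs.
From mathcomp Require Import all_boot all_order all_algebra.
From mathcomp Require Import all_classical all_reals all_analysis.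
From mathcomp Require Import zify ring lra.
Import Order.TTheory GRing.Theory Num.Theory.
Import numFieldNormedType.Exports.
Local Open Scope classical_set_scope.
Local Open Scope ring_scope.

(* Pell's equation provides an even multiple 2 v alpha = 2 A + sqrt D with
   D = x^2 - 1 even, and then infinitely many solutions of u^2 - D N^2 = 1 with u
   and N odd, for which tau = u - sqrt D * N satisfies 0 < tau N < 1 / 2. Suppose
   that N = n1 + n2. If alpha n1^2 and alpha n2^2 are both close to integers, then
   2 v alpha (n1^2 - n2^2) is close to an even integer; but it equals
   (2 A + sqrt D) N (n1 - n2), hence differs from the odd integer u (n1 - n2), up
   to an even one, by tau |n1 - n2| < 1 / 2. This bounds the closeness from below
   in terms of v. If eps tends to 0, it remains to exclude the representations
   with n2 bounded: when alpha (N - n2)^2 tends to the integers along the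
   solutions (u, N), the number sqrt D * n2^2 - 1 / (2 sqrt D) is an integer k,
   that is (2 D n2^2 - 1)^2 = 4 D k^2, which is impossible modulo 2. *)

(** * Solvability of Pell's equation *)

(** Pigeonhole: [Q + 2] fractional parts fall into [Q + 1] boxes of length [1 / (Q + 1)]. *)
Lemma dirichlet_approximation (R : realType) (t : R) (Q : nat) :
  exists (p : int) (q : nat),
    (0 < q <= Q.+1)%N /\ `|p%:~R - q%:R * t| < Q.+1%:R^-1.
Proof.
pose fr i : R := i%:R * t - (Num.floor (i%:R * t))%:~R.
have fr_ge0 i : 0 <= fr i by rewrite subr_ge0 floor_le.
have fr_lt1 i : fr i < 1.
  by rewrite ltrBlDl; have := floorD1_gt (i%:R * t); rewrite rmorphD.
have Q_gt0 : 0 < Q.+1%:R :> R by [].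
pose box i : nat := Num.truncn (Q.+1%:R * fr i).
have frQ_ge0 i : 0 <= Q.+1%:R * fr i by rewrite mulr_ge0.
have box_lt i : (box i < Q.+1)%N.
  by rewrite truncn_lt_nat// gtr_pMr.
have [/injectiveP /leq_card|/injectivePn] :=
    boolP (injectiveb (fun i : 'I_Q.+2 => inord (box i) : 'I_Q.+1)).
  by rewrite !card_ord ltnn.
have close i j : box i = box j -> `|fr i - fr j| < Q.+1%:R^-1.
  move=> eq_box.
  have := truncn_itv (frQ_ge0 i); have := truncn_itv (frQ_ge0 j).
  rewrite -/(box i) -/(box j) eq_box => /andP[lj uj] /andP[li ui].
  rewrite -(ltr_pM2l Q_gt0) divff ?gt_eqF// -[X in X * _]gtr0_norm// -normrM.
  rewrite mulrBr ltr_norml; move: ui uj; rewrite -natr1; lra.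
case=> i [j neq_ij /(congr1 val)]; rewrite /= !inordK// => eq_box.
wlog lt_ij : i j neq_ij eq_box / (i < j)%N.
  move=> IH; case: (ltngtP i j) => [|lt_ji|/val_inj eq_ij]; first exact: IH.
    by apply: (IH j i) => //; rewrite eq_sym.
  by rewrite eq_ij eqxx in neq_ij.
exists (Num.floor (j%:R * t) - Num.floor (i%:R * t)), (j - i)%N; split.
  by have := ltn_ord j; lia.
have -> : (Num.floor (j%:R * t) - Num.floor (i%:R * t))%:~R - (j - i)%:R * t
    = fr i - fr j.
  by rewrite rmorphB natrB ?(ltnW lt_ij)// /fr; ring.
exact: close.
Qed.

(** With [s = p - q t], the norm is [s (s + 2 t q)]; as [|s| q <= 1], it is at most [2 t + 1],
    however small [e] is. *)
Lemma bounded_norm_approximation (R : realType) (D : nat) :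
  exists M : nat, forall e : R, 0 < e -> exists (p q : int),
    `|p%:~R - q%:~R * Num.sqrt D%:R| < e /\ q != 0 /\
    `|p ^+ 2 - D%:Z * q ^+ 2| <= M%:Z.
Proof.
set t := Num.sqrt (D%:R : R).
have t_ge0 : 0 <= t by exact: sqrtr_ge0.
have tt : t * t = D%:R by rewrite -expr2 sqr_sqrtr.
exists (Num.truncn (2 * t + 1)).+1 => e e_gt0.
have [p [q [/andP[q_gt0 q_le] pq]]] := dirichlet_approximation _ t (Num.truncn e^-1).
set Q := (Num.truncn e^-1).+1 in q_le pq.
have Q_gt0 : 0 < Q%:R :> R by [].
have leQ : Q%:R^-1 < e.
  by rewrite invf_plt// /Q; exact: truncnS_gt.
have q_gt0R : 0 < q%:R :> R by rewrite ltr0n.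
have q_geR : 1 <= q%:R :> R by rewrite ler1n.
have q_leR : q%:R <= Q%:R :> R by rewrite ler_nat.
exists p, q%:Z; split; first exact: lt_trans pq _.
split; first by rewrite -lt0n in q_gt0 *; lia.
rewrite -(ler_int R) intr_norm.
have -> : (p ^+ 2 - D%:Z * q%:Z ^+ 2)%:~R =
    (p%:~R - q%:R * t) * ((p%:~R - q%:R * t) + 2 * t * q%:R).
  transitivity (p%:~R ^+ 2 - D%:R * q%:R ^+ 2 : R); first by ring.
  rewrite -tt; ring.
set s := p%:~R - q%:R * t in pq *.
have sq : `|s| * q%:R <= 1.
  have : `|s| * q%:R <= Q%:R^-1 * Q%:R by rewrite ler_pM// ltW.
  by rewrite mulVf// gt_eqF.
have s1 : `|s| <= 1 by apply: le_trans sq; rewrite ler_peMr.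
rewrite normrM.
have : `|s + 2 * t * q%:R| <= `|s| + 2 * t * q%:R.
  by apply: le_trans (ler_normD _ _) _; rewrite [X in _ + X]ger0_norm// !mulr_ge0// ltW.
move=> /(ler_wpM2l (normr_ge0 s)) /le_trans; apply.
have := truncnS_gt (2 * t + 1).
rewrite -[(_.+1%:Z)%:~R]/(_.+1%:R) => /ltW; apply: le_trans.
have : `|s| * `|s| <= 1 by rewrite mulr_ile1.
have := ler_wpM2l t_ge0 sq.
rewrite mulrDr; nra.
Qed.

(** Among infinitely many approximations of bounded norm, two have the same norm [f] and are
    congruent modulo [f]; their quotient is then integral and has norm 1. *)
Lemma pell_exists (R : realType) (D : nat) :
    ~ rational (Num.sqrt (D%:R : R)) ->
  exists x y : int, y != 0 /\ x ^+ 2 = D%:Z * y ^+ 2 + 1.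
Proof.
set t := Num.sqrt (D%:R : R) => t_irr.
have tt : t * t = D%:R by rewrite -expr2 sqr_sqrtr.
have [M approx] := bounded_norm_approximation R D.
pose gap (z : int * int) := `|z.1%:~R - z.2%:~R * t|.
pose nrm (z : int * int) := z.1 ^+ 2 - D%:Z * z.2 ^+ 2.
have gap_gt0 z : z.2 != 0 -> 0 < gap z.
  move=> z2; rewrite normr_gt0 subr_eq0; apply/eqP => z1E; apply: t_irr.
  exists (z.1%:Q / z.2%:Q) => //.
  by rewrite fmorph_div /= !ratr_int z1E mulrC mulKf// intr_eq0.
have nrmE p q : (p ^+ 2 - D%:Z * q ^+ 2)%:~R =
    (p%:~R - q%:~R * t) * (p%:~R + q%:~R * t).
  transitivity (p%:~R ^+ 2 - D%:R * q%:~R ^+ 2 : R); first by ring.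
  rewrite -tt; ring.
have [next nextP] : {next : R -> int * int & forall e, 0 < e ->
    gap (next e) < e /\ (next e).2 != 0 /\ `|nrm (next e)| <= M%:Z}.
  apply: (@choice _ _ (fun e z => 0 < e ->
    gap z < e /\ z.2 != 0 /\ `|nrm z| <= M%:Z)) => e.
  have [e_gt0|] := ltP 0 e; last by exists (0, 0).
  by have [p [q pq]] := approx e e_gt0; exists (p, q).
(* Each term must beat the gap of its predecessor, so the gaps strictly decrease. *)
pose z k := iter k (fun z => next (gap z)) (next 1).
have zP k : (z k).2 != 0 /\ `|nrm (z k)| <= M%:Z.
  elim: k => [|k [zk _]]; first by have [] := nextP 1 ltr01.
  by have [] := nextP _ (gap_gt0 _ zk).
have gap_decr i j : (i < j)%N -> gap (z j) < gap (z i).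
  have step k : gap (z k.+1) < gap (z k).
    by have [] := nextP _ (gap_gt0 _ (zP k).1).
  elim: j => // j IH; rewrite ltnS leq_eqVlt => /predU1P[->//|/IH].
  exact: lt_trans.
have nrm_neq0 k : nrm (z k) != 0.
  have [z2 _] := zP k; apply/eqP => /(congr1 (fun m : int => m%:~R : R)).
  rewrite nrmE => /eqP; rewrite mulf_eq0 => /orP[] /eqP h; first by have := gap_gt0 (z k) z2; rewrite /gap h normr0 ltxx.
  have := gap_gt0 (- (z k).1, (z k).2) z2.
  by rewrite /gap /= rmorphN /= -opprD h oppr0 normr0 ltxx.
(* The shift by [M] makes the norm nonnegative, so that [absz] keeps its sign. *)
pose key k : 'I_(M + M).+1 * 'I_M.+1 * 'I_M.+1 :=
  (inord (absz (nrm (z k) + M%:Z)), inord (absz ((z k).1 %% nrm (z k))%Z),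
   inord (absz ((z k).2 %% nrm (z k))%Z)).
have [i [j [lt_ij eq_key]]] : exists i j, (i < j)%N /\ key i = key j.
  pose f (i : 'I_(#|{: 'I_(M + M).+1 * 'I_M.+1 * 'I_M.+1}|.+1)) := key i.
  have [/injectiveP /leq_card|/injectivePn] := boolP (injectiveb f).
    by rewrite card_ord ltnn.
  move=> [i [j neq_ij eq_ij]].
  case: (ltngtP i j) => [lt_ij|lt_ji|/val_inj eq]; first by exists i, j.
    by exists j, i.
  by rewrite eq eqxx in neq_ij.
have modK k a : @inord M (absz (a %% nrm (z k))%Z) = absz (a %% nrm (z k))%Z :> nat.
  rewrite inordK//; have [_ le_M] := zP k.
  have := modz_ge0 a (nrm_neq0 k); have := ltz_mod a (nrm_neq0 k); lia.
have nrmK k : @inord (M + M) (absz (nrm (z k) + M%:Z)) = absz (nrm (z k) + M%:Z) :> nat.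
  by rewrite inordK//; have [_ le_M] := zP k; lia.
case: eq_key => /(congr1 val)/=; rewrite !nrmK => eq_nrm.
have {}eq_nrm : nrm (z i) = nrm (z j).
  by have [_] := zP i; have [_] := zP j; lia.
move=> /(congr1 val)/= + /(congr1 val)/=; rewrite !modK => eq1 eq2.
have mod1 : ((z i).1 = (z j).1 %[mod nrm (z i)])%Z.
  by rewrite -[LHS]gez0_abs ?modz_ge0// eq1 -eq_nrm gez0_abs ?modz_ge0.
have mod2 : ((z i).2 = (z j).2 %[mod nrm (z i)])%Z.
  by rewrite -[LHS]gez0_abs ?modz_ge0// eq2 -eq_nrm gez0_abs ?modz_ge0.
move/eqP: mod1; rewrite eqz_mod_dvd => /dvdzP[a aE].
move/eqP: mod2; rewrite eqz_mod_dvd => /dvdzP[b bE].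
have := gap_decr i j lt_ij; have := gap_gt0 _ (zP j).1; rewrite /gap.
have := nrm_neq0 i; move: eq_nrm aE bE; rewrite /nrm.
move: (z i) (z j) => [p1 q1] [p2 q2] /=.
set f := p1 ^+ 2 - D%:Z * q1 ^+ 2 => eq_nrm aE bE f_neq0 gap2_gt0 gap_lt.
(* [x + y t] is the quotient of [p1 - q1 t] by [p2 - q2 t]. *)
pose x := 1 - a * p1 + D%:Z * b * q1; pose y := a * q1 - b * p1.
have xE : f * x = p1 * p2 - D%:Z * q1 * q2.
  have -> : p2 = p1 - a * f by rewrite -aE; ring.
  have -> : q2 = q1 - b * f by rewrite -bE; ring.
  rewrite /x /f; ring.
have yE : f * y = p1 * q2 - p2 * q1.
  have -> : p2 = p1 - a * f by rewrite -aE; ring.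
  have -> : q2 = q1 - b * f by rewrite -bE; ring.
  rewrite /y; ring.
have pell : x ^+ 2 = D%:Z * y ^+ 2 + 1.
  apply: (mulfI (expf_neq0 2 f_neq0)).
  transitivity ((f * x) ^+ 2); first by ring.
  transitivity (D%:Z * (f * y) ^+ 2 + f * (p2 ^+ 2 - D%:Z * q2 ^+ 2)); last first.
    by rewrite -eq_nrm; ring.
  rewrite xE yE /f; ring.
(* If [y = 0], then [x] is 1 or -1 and the two gaps coincide, although they strictly decrease. *)
exists x, y; split=> //; apply/eqP => y0.
have x1 : `|x| = 1.
  by apply/eqP; rewrite -(@eqrXn2 _ 2)// real_normK ?num_real// pell y0 expr0n /= mulr0 add0r expr1n.
have : (p1%:~R - q1%:~R * t) * (p2%:~R + q2%:~R * t) =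
       x%:~R * (p2%:~R - q2%:~R * t) * (p2%:~R + q2%:~R * t).
  transitivity ((f * x)%:~R + (f * y)%:~R * t : R).
    rewrite xE yE.
    transitivity (p1%:~R * p2%:~R - D%:R * q1%:~R * q2%:~R
      + (p1%:~R * q2%:~R - p2%:~R * q1%:~R) * t : R); last by ring.
    rewrite -tt; ring.
  by rewrite y0 eq_nrm mulr0 mul0r addr0 rmorphM /= nrmE; ring.
move/mulIf => gap_eq; move: gap_lt; rewrite gap_eq; last first.
  by apply: contraNneq f_neq0 => h; rewrite eq_nrm -(intr_eq0 R) nrmE h mulr0.
by rewrite normrM -intr_norm x1 mul1r ltxx.
Qed.

(* Multiplication by [(x + sqrt D)^2] preserves the parity of [N]. *)
Lemma pell_odd_large (x D M : nat) : (x * x = D + 1)%N -> (0 < x)%N ->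
  exists u N : nat, [/\ (u * u = D * (N * N) + 1)%N, odd N & (M < N)%N].
Proof.
move=> xx x_gt0; elim: M => [|M [u [N [uu oddN MN]]]].
  by exists x, 1%N; split=> //; lia.
(* The coefficients are those of [(x + sqrt D)^2 = 2 D + 1 + 2 x sqrt D], as [x^2 = D + 1]. *)
exists ((2 * D + 1) * u + 2 * x * D * N)%N, (2 * x * u + (2 * D + 1) * N)%N.
split.
- transitivity ((2 * D + 1) * (2 * D + 1) * (u * u) + 4 * (x * x) * D * D * (N * N)
      + 4 * (2 * D + 1) * x * D * u * N)%N; first by ring.
  transitivity (D * (4 * (x * x) * (u * u) + (2 * D + 1) * (2 * D + 1) * (N * N)
      + 4 * (2 * D + 1) * x * u * N) + 1)%N; last by ring.
  rewrite uu xx; ring.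
- by rewrite oddD !oddM /= oddD oddM /= oddN.
- have : (0 < u)%N by case: u uu => //; lia.
  move=> /(conj x_gt0)/andP; rewrite -muln_gt0.
  by move: (D * N)%N (mulnDl (2 * D) 1 N) => c; lia.
Qed.

(** * A multiple of [alpha] adapted to Pell's equation *)

(** Clear denominators to [m alpha = A + B t] and solve [x^2 = 4 B^2 d y^2 + 1]. Multiplying by
    [2 y], up to sign, turns the irrational part into the square root of [x^2 - 1]. *)
Lemma pell_multiple (R : realType) (d : nat) (alpha : R) :
    (adjoin_rat (Num.sqrt (d%:R : R)) `\` @rational R) alpha ->
  exists (v A : int) (x D : nat),
    [/\ v != 0, (0 < D)%N, ~~ odd D, (x * x = D + 1)%N &
        (2 * v)%:~R * alpha = (2 * A)%:~R + Num.sqrt D%:R].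
Proof.
case=> /adjoin_rat_sqrtE[a [b alphaE]] alpha_irr.
set t := Num.sqrt d%:R in alphaE.
have [m [A [B [m_neq0 multE]]]] : exists m A B : int,
    m != 0 /\ m%:~R * alpha = A%:~R + B%:~R * t.
  have ratE (q : rat) : ratr q = (numq q)%:~R / (denq q)%:~R :> R by [].
  have den_neq0 (q : rat) : (denq q)%:~R != 0 :> R by rewrite intr_eq0 denq_neq0.
  exists (denq a * denq b), (numq a * denq b), (numq b * denq a).
  rewrite mulf_neq0 ?denq_neq0//; split=> //.
  by rewrite alphaE !ratE !rmorphM /=; field; rewrite !den_neq0.
(* The factor 4 accounts for the even multiple of [alpha] and makes [D = D0 y^2] even. *)
pose D0 := (4 * absz B ^ 2 * d)%N.
have sqrtM (k : nat) : Num.sqrt ((k ^ 2 * d)%N%:R : R) = k%:R * t.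
  by rewrite natrM natrX sqrtrM ?sqr_ge0// sqrtr_sqr ger0_norm.
have D0E : Num.sqrt D0%:R = 2 * `|B%:~R| * t :> R.
  by rewrite /D0 -[4%N]/(2 ^ 2)%N -expnMn sqrtM natrM -intr_norm -abszE.
have D0_irr : ~ rational (Num.sqrt (D0%:R : R)).
  case=> r _; rewrite D0E => rE; apply: alpha_irr.
  exists ((A%:~R + (sgz B)%:~R * r / 2) / m%:~R) => //.
  have BE : (sgz B)%:~R * (2 * `|B%:~R| * t) / 2 = B%:~R * t.
    by rewrite [in RHS](intEsg B) rmorphM /= abszE intr_norm; field.
  rewrite fmorph_div rmorphD fmorph_div rmorphM /= !ratr_int ratr_nat rE BE -multE.
  by rewrite mulrC mulKf// intr_eq0.
have [x [y [y_neq0 xy]]] := pell_exists R D0 D0_irr.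
have B_neq0 : B != 0.
  apply/eqP => B0; apply: D0_irr; rewrite D0E B0 normr0 mulr0 mul0r.
  by exists 0; rewrite ?rmorph0.
have d_gt0 : (0 < d)%N.
  rewrite lt0n; apply/eqP => d0; apply: D0_irr; rewrite D0E /t d0 sqrtr0 mulr0.
  by exists 0; rewrite ?rmorph0.
(* The sign makes [B y'] positive, so that [2 B y' t] is [sqrt D] and not its opposite. *)
pose y' := sgz B * `|y|.
have By' : B * y' = `|B| * `|y| by rewrite /y' mulrA; congr (_ * _); lia.
exists (m * y'), (A * y'), (absz x), ((2 * absz B * absz y) ^ 2 * d)%N.
split.
- by rewrite !mulf_neq0 ?sgz_eq0 ?normr_eq0.
- by rewrite muln_gt0 expn_gt0 !muln_gt0 !absz_gt0 B_neq0 y_neq0.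
- by rewrite oddM oddX !oddM.
- suff [] : Posz (absz x * absz x) = Posz ((2 * absz B * absz y) ^ 2 * d + 1) by [].
  transitivity (x ^+ 2); first by rewrite PoszM abszE -expr2 real_normK ?num_real.
  rewrite xy -(real_normK (num_real y)) -abszE /D0.
  by rewrite !(PoszM, PoszD, expnS, expn0); ring.

- rewrite sqrtM.
  have -> : (2 * absz B * absz y)%N%:R = 2 * (B * y')%:~R :> R.
    by rewrite By' -!abszE !natrM rmorphM /= mulrA.
  rewrite mulrA (rmorphM _ (2 * _)) /=.
  transitivity (2 * y'%:~R * (m%:~R * alpha)); first by ring.
  by rewrite multE; ring.
Qed.

Lemma ge1_norm_odd (R : realType) (j : int) : 1 <= `|(2 * j + 1)%:~R : R|.
Proof. by rewrite -intr_norm ler1z; lia. Qed.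

(** * The small conjugate of a Pell unit *)

Section PellGap.
Variables (R : realType) (D u N : nat).
Hypotheses (D_gt0 : (0 < D)%N) (uN : (u * u = D * (N * N) + 1)%N).
Hypothesis N_gt0 : (0 < N)%N.
Let s : R := Num.sqrt D%:R.
Let tau : R := u%:R - s * N%:R.

Lemma pell_gap_facts : [/\ s * s = D%:R, 1 <= s & tau * (u%:R + s * N%:R) = 1 ].
Proof.
have ss : s * s = D%:R by rewrite -expr2 sqr_sqrtr.
split=> //; first by rewrite -[X in X <= _]sqrtr1 ler_wsqrtr// ler1n.
have := congr1 (fun n => n%:R : R) uN; rewrite natrD !natrM -ss /tau => uNR.
transitivity (u%:R * u%:R - s * s * (N%:R * N%:R)); first by ring.
by rewrite uNR; ring.
Qed.

Lemma pell_gap_gt0 : 0 < tau.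
Proof.
have [_ s1 tauE] := pell_gap_facts.
have : 0 < tau * (u%:R + s * N%:R) by rewrite tauE.
by rewrite pmulr_lgt0// ltr_wpDl// mulr_gt0 ?ltr0n//; lra.
Qed.

(** Substituting [u = tau + s N] in [tau (u + s N) = 1] gives [tau^2 + 2 s tau N = 1], so the
    difference is [tau^2 / (2 s)], where [tau <= 1 <= s]. *)
Lemma pell_gap_lim : 0 <= (2 * s)^-1 - tau * N%:R <= tau.
Proof.
have [_ s1 tauE] := pell_gap_facts; have tau_gt0 := pell_gap_gt0.
have N1 : 1 <= N%:R :> R by rewrite ler1n.
have sN1 : 1 <= s * N%:R by rewrite -[leLHS]mulr1 ler_pM.
have uE : u%:R = tau + s * N%:R by rewrite /tau; ring.
have tau1 : tau <= 1 by rewrite -[leRHS]tauE ler_peMr ?ltW// uE; lra.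
have -> : (2 * s)^-1 - tau * N%:R = tau * tau / (2 * s).
  have {1}-> : (2 * s)^-1 = tau * (u%:R + s * N%:R) / (2 * s) by rewrite tauE mul1r.
  rewrite uE; field; lra.
have s2 : 0 < 2 * s by lra.
rewrite divr_ge0 ?ler_pdivrMr ?mulr_ge0 ?(ltW tau_gt0) ?(ltW s2)//=; nra.
Qed.

End PellGap.

(** * Obstructions to representing [N] *)

Section NonRepresentation.
Variables (R : realType) (alpha : R) (v A : int) (D u N : nat).
Hypotheses (D_gt0 : (0 < D)%N) (D_even : ~~ odd D).
Hypothesis alphaE : (2 * v)%:~R * alpha = (2 * A)%:~R + Num.sqrt D%:R.
Hypotheses (uN : (u * u = D * (N * N) + 1)%N) (N_odd : odd N).
Let s : R := Num.sqrt D%:R.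
Let tau : R := u%:R - s * N%:R.
Let N_gt0 : (0 < N)%N. Proof. exact: odd_gt0. Qed.

(* Both [u] and [n1 - n2] are odd, so that
   [2 v alpha (n1^2 - n2^2) = (2 A + sqrt D) N (n1 - n2)] is an odd integer up
   to the error [tau (n1 - n2)], which is at most [1 / 2]. *)
Lemma both_close (n1 n2 : nat) (e : R) : (n1 + n2)%N = N ->
    dist_int (alpha * n1%:R ^+ 2) < e -> dist_int (alpha * n2%:R ^+ 2) < e ->
  1 <= 4 * `|(2 * v)%:~R| * e.
Proof.
move=> nE.
have [[z1 ->] _] := dist_intP (alpha * n1%:R ^+ 2).
have [[z2 ->] _] := dist_intP (alpha * n2%:R ^+ 2).
set X := _ - z1%:~R; set Y := _ - z2%:~R => X_lt Y_lt.
have [_ s1 _] := pell_gap_facts R D u N D_gt0 uN.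
have tau_gt0 := pell_gap_gt0 R D u N D_gt0 uN N_gt0.
have /andP[lim_ge0 _] := pell_gap_lim R D u N D_gt0 uN N_gt0.
rewrite -/s -/tau in s1 tau_gt0 lim_ge0.
have u_odd : odd u.
  have := congr1 odd uN; rewrite oddD !oddM (negbTE D_even) /=; by case: odd.
pose u' := u./2; pose N' := N./2.
have uE : u%:Z = 2 * u'%:Z + 1 by rewrite -[in LHS](odd_double_half u) u_odd /u'; lia.
have NE : N%:Z = 2 * N'%:Z + 1 by rewrite -[in LHS](odd_double_half N) N_odd /N'; lia.
pose m : int := n1%:Z - n2%:Z.
have mE : m = 2 * (N'%:Z - n2%:Z) + 1 by rewrite /m; lia.
pose j : int := A * N%:Z * m + (u'%:Z * m + (N'%:Z - n2%:Z)) - v * (z1 - z2).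
have key : (2 * v)%:~R * (X - Y) = (2 * j + 1)%:~R - tau * m%:~R.
  have -> : 2 * j + 1 = 2 * A * N%:Z * m + u%:Z * m - 2 * v * (z1 - z2).
    by rewrite /j uE mE; ring.
  transitivity ((2 * v)%:~R * alpha * (n1%:R ^+ 2 - n2%:R ^+ 2)
     - (2 * v)%:~R * (z1%:~R - z2%:~R)); first by rewrite /X /Y; ring.
  by rewrite alphaE -/s /tau /m -nE; ring.
have m_le : `|tau * m%:~R| <= 2^-1.
  have : `|m%:~R| <= N%:R :> R.
    by rewrite -intr_norm -[N%:R]/(N%:~R) ler_int /m -nE; lia.
  rewrite normrM gtr0_norm// => /(ler_wpM2l (ltW tau_gt0)) /le_trans; apply.
  apply: (@le_trans _ _ (2 * s)^-1); first by rewrite -subr_ge0.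
  by rewrite lef_pV2 ?posrE; lra.
(* An odd integer has absolute value at least 1; the error takes at most [1 / 2], and
   [|X - Y| <= 2 e], whence the factor 4. *)
have := ge1_norm_odd R j.
have -> : (2 * j + 1)%:~R = (2 * v)%:~R * (X - Y) + tau * m%:~R by rewrite key; ring.
move=> /le_trans /(_ (ler_normD _ _)); rewrite normrM.
have : `|X - Y| <= e + e by apply: le_trans (ler_normB _ _) _; rewrite lerD// ltW.
move=> /(ler_wpM2l (normr_ge0 (2 * v)%:~R)); lra.
Qed.

(* Here [2 v alpha n1^2] is, up to an integer and errors of order [tau], equal to
   [s n2^2 - tau N], and [tau N] is close to [(2 s)^-1]. *)
Lemma one_close (n1 n2 : nat) (c e : R) : (n1 + n2)%N = N ->
    (forall k : int, c <= `|s * n2%:R ^+ 2 - (2 * s)^-1 - k%:~R|) ->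
    dist_int (alpha * n1%:R ^+ 2) < e ->
  c <= `|(2 * v)%:~R| * e + (2 * n2 + 1)%:R / N%:R.
Proof.
move=> nE cP.
have [[z ->] _] := dist_intP (alpha * n1%:R ^+ 2).
set X := _ - z%:~R => X_lt.
have [_ s1 _] := pell_gap_facts R D u N D_gt0 uN.
have tau_gt0 := pell_gap_gt0 R D u N D_gt0 uN N_gt0.
have /andP[lim_ge0 lim_le] := pell_gap_lim R D u N D_gt0 uN N_gt0.
rewrite -/s -/tau in s1 tau_gt0 lim_ge0 lim_le.
set l := (2 * s)^-1 - tau * N%:R in lim_ge0 lim_le.
(* The integer part comes from [s n1^2 = s N (N - 2 n2) + s n2^2] and [s N = u - tau]. *)
pose k : int := 2 * v * z - 2 * A * n1%:Z ^+ 2 - u%:Z * (N%:Z - 2 * n2%:Z).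
have key : s * n2%:R ^+ 2 - (2 * s)^-1 - k%:~R =
    (2 * v)%:~R * X - l - 2 * n2%:R * tau.
  transitivity ((2 * v)%:~R * alpha * n1%:R ^+ 2 - (2 * v)%:~R * z%:~R
    - l - 2 * n2%:R * tau); last by rewrite /X; ring.
  rewrite alphaE -/s /k /l /tau -nE; ring.
have tauN : tau <= N%:R^-1.
  rewrite -[N%:R^-1]mul1r ler_pdivlMr ?ltr0n//.
  apply: (@le_trans _ _ (2 * s)^-1); first by rewrite -subr_ge0.
  by rewrite invf_le1; lra.
apply: (le_trans (cP k)); rewrite key -addrA.
apply: le_trans (ler_normD _ _) _; apply: lerD.
  by rewrite normrM ler_wpM2l// ltW.
rewrite -opprD normrN ger0_norm; last by rewrite addr_ge0// mulr_ge0// ltW.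
have := ler_wpM2l (ler0n R (2 * n2 + 1)) tauN.
rewrite natrD natrM; lra.
Qed.

End NonRepresentation.

(** * Nonintegrality of the limit *)

Lemma half_gap_not_int (R : realType) (D n : nat) (k : int) : (0 < D)%N ->
  Num.sqrt D%:R * n%:R ^+ 2 - (2 * Num.sqrt D%:R)^-1 != k%:~R :> R.
Proof.
move=> D_gt0; set s := Num.sqrt D%:R : R; apply/eqP => kE.
have s_gt0 : 0 < s by rewrite sqrtr_gt0 ltr0n.
have ss : s * s = D%:R by rewrite -expr2 sqr_sqrtr.
have : (2 * D%:Z * n%:Z ^+ 2 - 1) ^+ 2 = 4 * D%:Z * k ^+ 2.
  apply: (@intr_inj R).
  transitivity ((2 * D%:R * n%:R ^+ 2 - 1) ^+ 2 : R); first by ring.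
  transitivity (4 * D%:R * k%:~R ^+ 2 : R); last by ring.
  rewrite -kE -ss; field; lra.
move: (n%:Z ^+ 2) (k ^+ 2) => a b.
have -> : (2 * D%:Z * a - 1) ^+ 2 = 2 * (2 * (D%:Z * a) ^+ 2 - 2 * (D%:Z * a)) + 1.
  by ring.
lia.
Qed.

(** Finitely many positive distances have a positive minimum. It depends on [K] only, so [N] can be
    chosen after it. *)
Lemma half_gap_lower_bound (R : realType) (D K : nat) : (0 < D)%N ->
  exists2 c : R, 0 < c & forall (n : nat) (k : int), (n < K)%N ->
    c <= `|Num.sqrt D%:R * n%:R ^+ 2 - (2 * Num.sqrt D%:R)^-1 - k%:~R|.
Proof.
move=> D_gt0; elim: K => [|K [c c_gt0 cP]]; first by exists 1.
have [[k0 k0E] dist_le] :=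
  dist_intP (Num.sqrt D%:R * K%:R ^+ 2 - (2 * Num.sqrt D%:R)^-1 : R).
exists (Num.min c (dist_int (Num.sqrt D%:R * K%:R ^+ 2 - (2 * Num.sqrt D%:R)^-1))).
  by rewrite lt_min c_gt0 k0E normr_gt0 subr_eq0 half_gap_not_int.
move=> n k; rewrite ltnS leq_eqVlt ge_min => /predU1P[->|/cP->//].
by rewrite dist_le orbT.
Qed.

(** * Choice of thresholds and conclusion *)

Theorem proposition1p4 (R : realType) (d : nat) (alpha : R)
    (halpha : (adjoin_rat (Num.sqrt (d%:R : R)) `\` @rational R) alpha) :
  exists eps1 : R, 0 < eps1 /\
    forall eps : nat -> R, (forall n : nat, 0 < eps n) ->
      (exists eps0 : R, eps0 < eps1 /\ forall n : nat, eps n <= eps0) \/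
      (eps n @[n --> \oo] --> (0 : R)) ->
      ~ basis_order2 [set n : nat | dist_int (alpha * n%:R ^+ 2) < eps n].
Proof.
have [v [A [x [D [v_neq0 D_gt0 D_even xD alphaE]]]]] := pell_multiple _ _ _ halpha.
have x_gt0 : (0 < x)%N by case: x xD => //; lia.
set w : R := `|(2 * v)%:~R|.
have w_gt0 : 0 < w by rewrite normr_gt0 intr_eq0 mulf_neq0.
(* Below this value the bound of [both_close] fails. *)
exists (4 * w)^-1; split; first by rewrite invr_gt0 mulr_gt0.
move=> eps eps_gt0 epsP [M _ basis].
have not_both u N n1 n2 : (u * u = D * (N * N) + 1)%N -> odd N ->
    (n1 + n2)%N = N -> eps n1 < (4 * w)^-1 -> eps n2 < (4 * w)^-1 ->
    dist_int (alpha * n1%:R ^+ 2) < eps n1 ->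
    dist_int (alpha * n2%:R ^+ 2) < eps n2 -> False.
  move=> uN N_odd nE lt1 lt2 d1 d2.
  pose e := Num.max (eps n1) (eps n2).
  have e_lt : e < (4 * w)^-1 by rewrite gt_max lt1.
  have := both_close R alpha v A D u N D_gt0 D_even alphaE uN N_odd n1 n2 e nE.
  rewrite !lt_max d1 d2 orbT => /(_ isT isT); apply/negP; rewrite -ltNge.
  by move: e_lt; rewrite -[(4 * w)^-1]mul1r ltr_pdivlMr ?mulr_gt0// -/w; lra.
case: epsP => [[eps0 [eps0_lt eps_le]]|eps_cvg].
  have [u [N [uN N_odd MN]]] := pell_odd_large x D M xD x_gt0.
  have [n1 d1 [n2 d2 nE]] := basis N (ltnW MN).
  by apply: (not_both _ _ _ _ uN N_odd nE _ _ d1 d2); exact: le_lt_trans eps0_lt.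
have eps_small e : 0 < e -> exists K : nat, forall n, (K <= n)%N -> eps n < e.
  move=> e_gt0; have /cvgrPdist_lt /(_ e e_gt0) [K _ KP] := eps_cvg.
  by exists K => n /KP; rewrite /= sub0r normrN gtr0_norm.
(* Two summands that are both at least [K] are excluded by [not_both]; below, [L] and [T] make each
   error term of [one_close] less than [c / 2] when one summand is below [K]. *)
have [K KP] := eps_small (4 * w)^-1 ltac:(by rewrite invr_gt0 mulr_gt0).
have [c c_gt0 cP] := half_gap_lower_bound R D K D_gt0.
have [L LP] := eps_small (c / (2 * w)) ltac:(by rewrite divr_gt0 ?mulr_gt0).
pose T := Num.truncn (2 * (2 * K + 1)%:R / c : R).
have [u [N [uN N_odd]]] := pell_odd_large x D (M + K + L + T) xD x_gt0.
move=> N_gt; have [n1 d1 [n2 d2 nE]] := basis N ltac:(by rewrite /=; lia).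
have not_small n m : (n + m)%N = N -> (m < K)%N ->
    dist_int (alpha * n%:R ^+ 2) < eps n -> False.
  move=> nmE mK dn.
  have := one_close R alpha v A D u N D_gt0 alphaE uN N_odd n m c (eps n) nmE
    (fun k => cP m k mK) dn.
  apply/negP; rewrite -ltNge -/w.
  have : w * eps n < c / 2.
    have /LP : (L <= n)%N by lia.
    by rewrite ltr_pdivlMr ?mulr_gt0//; lra.
  have : (2 * m + 1)%:R / N%:R < c / 2 :> R.
    have TN : (T.+1 <= N)%N by lia.
    have N_gt0 : 0 < N%:R :> R by rewrite ltr0n; lia.
    rewrite ltr_pdivrMr//.
    have /le_lt_trans : (2 * m + 1)%:R <= (2 * K + 1)%:R :> R by rewrite ler_nat; lia.
    apply; have := truncnS_gt (2 * (2 * K + 1)%:R / c : R); rewrite -/T.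
    have : T.+1%:R <= N%:R :> R by rewrite ler_nat.
    move=> /[swap] /lt_le_trans /[apply]; rewrite ltr_pdivrMr//; lra.
  lra.
have [n2K|Kn2] := ltnP n2 K; first exact: (not_small n1 n2).
have [n1K|Kn1] := ltnP n1 K; first by apply: (not_small n2 n1); rewrite // addnC.
exact: (not_both _ _ _ _ uN N_odd nE (KP _ Kn1) (KP _ Kn2) d1 d2).
Qed.
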